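(* Let $n\ge 2$ and let $k,j$ be positive integers with $\gcd(k,j)=1$ and $k+j<n$. If a vertex $\mathbf a=a_1\cdots a_n$ of $G(n)$ is contained in some $k$-cycle of $G(n)$, then $\mathbf a$ is not contained in any $j$-cycle of $G(n)$.
   Context: For a sequence of distinct integers $c_1\cdots c_t$, $\mathrm{st}(c_1\cdots c_t)$ is the unique permutation $d_1\cdots d_t$ of $\{1,\dots,t\}$ with $d_i<d_j$ iff $c_i<c_j$. $G(n)$ is the directed multigraph whose vertices are the permutations of $\{1,\dots,n\}$ (one-line notation) and whose edges are the permutations $c_1\cdots c_{n+1}$ of $\{1,\dots,n+1\}$, the edge $c_1\cdots c_{n+1}$ going from $\mathrm{st}(c_1\cdots c_n)$ to $\mathrm{st}(c_2\cdots c_{n+1})$; so there is an edge from $x_1\cdots x_n$ to $w_1\cdots w_n$ iff $\mathrm{st}(x_2\cdots x_n)=\mathrm{st}(w_1\cdots w_{n-1})$. A $k$-cycle is a closed walk $(v_1,\dots,v_k)$ (edges from $v_i$ to $v_{i+1}$ for $i<k$ and from $v_k$ to $v_1$) whose vertices $v_1,\dots,v_k$ are pairwise distinct; a $1$-cycle is a loop.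
   Formalization: The case k = j = 1 is excluded: there gcd(k,j) = 1 and k + j < n hold for n ≥ 3, but the vertex 12...n has a loop (the edge 12...(n+1)), so it is contained in a 1-cycle and the claim fails. *)

(* Defs.v *)
From mathcomp Require Import all_boot all_fingroup.
Set Implicit Arguments.
Unset Strict Implicit.
Unset Printing Implicit Defensive.

(* The entry x is replaced by its rank in c, counted from 1. For duplicate-free
   c this is the permutation of {1, .., size c} ordered like c, and the only
   one: see perm_eq_st, ltn_nth_st and st_unique. *)
Definition st (c : seq nat) : seq nat :=
  [seq count (fun y => y <= x) c | x <- c].

(* 'S_n permutes {0, .., n-1}; the shift yields a word on {1, .., n}. *)
Definition oneline n (s : 'S_n) : seq nat := [seq (s i).+1 | i <- enum 'I_n].

Definition is_edge n (c : 'S_n.+1) (x w : 'S_n) : bool :=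
  (st (take n (oneline c)) == oneline x) && (st (drop 1 (oneline c)) == oneline w).

Definition adj n : rel 'S_n := fun x w => [exists c : 'S_n.+1, is_edge c x w].

(* ucycleb also asks for the closing edge from the last vertex to the first, so
   that a 1-cycle is a loop. *)
Definition is_kcycle n k (p : seq 'S_n) : bool :=
  (size p == k) && ucycleb (@adj n) p.

Definition in_kcycle n k (a : 'S_n) : Prop :=
  exists2 p : seq 'S_n, is_kcycle k p & a \in p.

Lemma size_st c : size (st c) = size c.
Proof. exact: size_map. Qed.

Lemma ltn_nth_st c i j : i < size c -> j < size c ->
  (nth 0 (st c) i < nth 0 (st c) j) = (nth 0 c i < nth 0 c j).
Proof.
move=> ic jc; rewrite !(nth_map 0) //.
have [lt_ij|le_ji] := ltnP (nth 0 c i); last first.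
  by rewrite ltnNge; apply/negbF/sub_count => z /leq_trans; apply.
have jP : 0 < count (pred1 (nth 0 c j)) c.
  by rewrite -has_count has_pred1 mem_nth.
apply: leq_trans (_ : count (fun y => y <= nth 0 c i) c
                      + count (pred1 (nth 0 c j)) c <= _).
  by rewrite -addn1 leq_add2l.
rewrite -count_predUI [X in _ + X](_ : _ = 0) ?addn0.
  apply: sub_count => z /= /orP[zi|/eqP->//].
  exact: leq_trans zi (ltnW lt_ij).
rewrite (eq_count (a2 := pred0)) ?count_pred0 // => z /=.
by apply/andP => -[zi /eqP zj]; rewrite zj leqNgt lt_ij in zi.
Qed.

Lemma perm_eq_st c : uniq c -> perm_eq (st c) (iota 1 (size c)).
Proof.
move=> uc.
have ust : uniq (st c).
  apply/(uniqP 0) => i j; rewrite !inE size_st => ic jc eq_ij.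
  apply/eqP; rewrite -(nth_uniq 0 ic jc uc).
  by case: ltngtP; rewrite // -ltn_nth_st // eq_ij ltnn.
apply: uniq_perm => //; first exact: iota_uniq.
apply: (uniq_min_size ust _ _).2; last by rewrite size_iota size_st.
move=> _ /mapP[x xc ->]; rewrite mem_iota add1n ltnS count_size andbT -has_count.
by apply/hasP; exists x.
Qed.

Lemma st_unique c d : perm_eq d (iota 1 (size c)) ->
  (forall i j, i < size c -> j < size c ->
    (nth 0 d i < nth 0 d j) = (nth 0 c i < nth 0 c j)) ->
  d = st c.
Proof.
move=> pd ord.
have sd : size d = size c by rewrite (perm_size pd) size_iota.
apply: (@eq_from_nth _ 0); rewrite ?size_st // sd => i ic.
rewrite (nth_map 0) //.
have di : nth 0 d i \in iota 1 (size c) by rewrite -(perm_mem pd) mem_nth ?sd.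
have -> : count (fun y => y <= nth 0 c i) c = count (fun y => y <= nth 0 d i) d.
  rewrite -{2}[c](mkseq_nth 0) -{2}[d](mkseq_nth 0) sd !count_map.
  apply: eq_in_count => l; rewrite mem_iota add0n => /= lc.
  by rewrite leqNgt -ord // -leqNgt.
rewrite (seq.permP pd) -size_filter.
move: di; rewrite mem_iota add1n ltnS => /andP[d0 dc].
rewrite -(subnKC dc) iotaD filter_cat size_cat.
rewrite (_ : [seq _ <- iota 1 _ | _] = iota 1 (nth 0 d i)); last first.
  by apply/all_filterP/allP => x; rewrite mem_iota add1n ltnS => /andP[].
rewrite size_iota (_ : [seq _ <- _ | _] = [::]) ?addn0 //.
apply/eqP; rewrite -(negbK (_ == _)) -has_filter.
apply/hasPn => x; rewrite mem_iota add1n -ltnNge.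
by case/andP.
Qed.

(* Main.v *)
Require Import Defs.
From mathcomp Require Import all_boot all_fingroup.
From mathcomp Require Import zify.

Set Implicit Arguments.
Unset Strict Implicit.
Unset Printing Implicit Defensive.

(** Let s be the word of length n - 1 recording at which positions a ascends.
    An edge shifts this word by one, so a closed walk of length k through a makes
    k a period of s. Two coprime periods k, j with k + j <= n - 1 force s to be
    constant by the Fine-Wilf theorem, hence a is monotone. But along a closed
    walk of length k < n through a monotone a, every letter of the ascent word of
    each vertex is inherited from one of the two end copies of a, so all the
    vertices equal a; as the vertices of a cycle are distinct, k = 1. Likewise
    j = 1. *)

(** Euclid's algorithm on the pair of periods, by induction on [p + q]. *)
Lemma Fine_Wilf_coprime (T : Type) (f : nat -> T) (p q N : nat) :
  coprime p q -> p + q <= N ->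
  (forall i, i + p < N -> f (i + p) = f i) ->
  (forall i, i + q < N -> f (i + q) = f i) ->
  forall i, i < N -> f i = f 0.
Proof.
have [m] := ubnP (p + q); elim: m => // m IHm in p q N *.
wlog le_pq : p q / p <= q => [hwlog|].
  have [/hwlog//|/ltnW le_qp] := leqP p q.
  rewrite coprime_sym addnC => lt_m co le_N per_p per_q.
  exact: (hwlog q p).
case: (posnP p) => [->|p_gt0] lt_m co le_N per_p per_q.
  move: co per_q; rewrite /coprime gcd0n => /eqP-> per1.
  by elim=> // i IHi lt_iN; rewrite -addn1 per1 ?addn1 // IHi // ltnW.
(* On the first [N - p] letters [q - p] is also a period: go forward by [q], then back by [p]. *)
have f_const i : i < N - p -> f i = f 0.
  apply: (IHm p (q - p)); rewrite ?subnKC //; try lia.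
  - by move: co; rewrite -{1}(subnKC le_pq) /coprime gcdnDl.
  - by move=> l ?; apply: per_p; lia.
  - move=> l ?; rewrite -per_p; last by lia.
    by rewrite -addnA subnK // per_q //; lia.
move=> i lt_iN; have [/f_const//|le_i] := ltnP i (N - p).
have le_pi : p <= i by lia.
by rewrite -(subnK le_pi) per_p ?subnK // f_const //; lia.
Qed.

Definition asc {n} (x : 'S_n) (i : nat) : bool :=
  nth 0 (oneline x) i < nth 0 (oneline x) i.+1.

Lemma size_oneline n (x : 'S_n) : size (oneline x) = n.
Proof. by rewrite size_map size_enum_ord. Qed.

Lemma oneline_inj n : injective (@oneline n).
Proof.
move=> x y /eq_in_map eq_xy; apply/permP => i; apply: val_inj.
by have [] := eq_xy i (mem_enum _ i).
Qed.

Lemma perm_oneline n (x y : 'S_n) : perm_eq (oneline x) (oneline y).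
Proof.
suff perm_id (z : 'S_n) : perm_eq (oneline z) [seq (val i).+1 | i <- enum 'I_n].
  by rewrite (perm_trans (perm_id x)) // perm_sym.
rewrite /oneline (map_comp (fun i : 'I_n => (val i).+1) z); apply: perm_map.
apply: uniq_perm; rewrite ?enum_uniq ?(map_inj_uniq perm_inj) ?enum_uniq //.
move=> i; rewrite mem_enum; apply/mapP; exists (z^-1%g i); first exact: mem_enum.
by rewrite permKV.
Qed.

(** Such words are sorted for [leq] or for [geq], and given letters have only one sorted
    arrangement. *)
Lemma asc_const_inj n (b : bool) (x y : 'S_n) :
  (forall i, i.+1 < n -> asc x i = b) -> (forall i, i.+1 < n -> asc y i = b) ->
  x = y.
Proof.
move=> asc_x asc_y; apply: oneline_inj.
pose r := if b then leq else geq.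
have r_sorted (z : 'S_n) : (forall i, i.+1 < n -> asc z i = b) -> sorted r (oneline z).
  move=> asc_z; apply/(sortedP 0) => i; rewrite size_oneline => lt_in.
  by move: (asc_z i lt_in); rewrite /asc /r; case: b {asc_x asc_y r asc_z} => /=; lia.
apply: (@sorted_eq _ r); rewrite ?r_sorted ?perm_oneline //.
  by rewrite /r; case: b {asc_x asc_y r r_sorted} => u v w /=; lia.
by rewrite /r; case: b {asc_x asc_y r r_sorted} => u v /=; lia.
Qed.

(** Both sides compare the same two adjacent entries of the edge [c], as [st] preserves order. *)
Lemma asc_adj n (x w : 'S_n) i : adj x w -> i.+2 < n -> asc w i = asc x i.+1.
Proof.
case/existsP=> c /andP[/eqP st_x /eqP st_w] lt_in.
rewrite /asc -st_x -st_w !ltn_nth_st ?size_take_min ?size_drop ?size_oneline;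
  try lia.
by rewrite !nth_drop !nth_take ?add1n //; lia.
Qed.

Lemma asc_walk n (v : nat -> 'S_n) : (forall m, adj (v m) (v m.+1)) ->
  forall l m i, (i + m).+1 < n -> asc (v (l + m)) i = asc (v l) (i + m).
Proof.
move=> adj_v l m; elim: m => [|m IHm] i lt_in; first by rewrite !addn0.
rewrite addnS (asc_adj (adj_v _)); last by lia.
by rewrite IHm addSnnS //; lia.
Qed.

(** Unrolling the cycle into an infinite walk avoids indices modulo [k]; the last clause keeps what
    is used of the distinctness of the vertices. *)
Lemma kcycle_walk n (k : nat) (a : 'S_n) : in_kcycle k a ->
  exists v : nat -> 'S_n, [/\ v 0 = a, v k = a, forall m, adj (v m) (v m.+1)
                            & v 1 = a -> k = 1].
Proof.
case=> p /andP[/eqP size_p /andP[cyc_p uniq_p]] a_p.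
have fcyc_p := cycle_next uniq_p.
have order_a : fingraph.order (next p) a = k.
  by rewrite (order_cycle fcyc_p uniq_p a_p).
exists (fun m => iter m (next p) a); split=> //.
- by rewrite -order_a (iter_order_cycle fcyc_p).
- move=> m; rewrite iterS; apply: next_cycle cyc_p _.
  by elim: m => //= m; rewrite mem_next.
- move=> next_a; rewrite -order_a (@order_cycle _ (next p) [:: a]) ?mem_head //=.
  by rewrite andbT; apply/eqP.
Qed.

Lemma kcycle_asc_const n k (a : 'S_n) (b : bool) : 0 < k -> k < n ->
  (forall i, i.+1 < n -> asc a i = b) -> in_kcycle k a -> k = 1.
Proof.
move=> k_gt0 lt_kn asc_a /kcycle_walk[v [v0 vk adj_v]]; apply.
apply: (@asc_const_inj n b) => // i lt_in.
have [lt_i1n|le_ni1] := ltnP i.+2 n.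
  by rewrite (asc_walk adj_v 0 (m := 1)) ?addn1 // v0 asc_a.
(* Here [i = n - 2], the one letter of [v 1] not inherited from [v 0]; [k - 1] further steps carry
   it into [v k = a], and [k < n] keeps it inside the word. *)
have le_ki : k.-1 <= i by lia.
rewrite -(subnK le_ki) -(asc_walk adj_v) ?subnK //.
by rewrite add1n prednK // vk asc_a //; lia.
Qed.

Lemma kcycle_asc_period n k (a : 'S_n) : in_kcycle k a ->
  forall i, i + k < n.-1 -> asc a (i + k) = asc a i.
Proof.
move=> /kcycle_walk[v [v0 vk adj_v _]] i lt_ikn.
by rewrite -{1}v0 -(asc_walk adj_v) ?vk //; lia.
Qed.

Theorem theorem5p4 (n k j : nat) (hn : 2 <= n) (hk : 0 < k) (hj : 0 < j)
    (hkj : coprime k j) (hlt : k + j < n) (hne : ~ (k = 1 /\ j = 1))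
    (a : 'S_n) :
  in_kcycle k a -> ~ in_kcycle j a.
Proof.
(* A monotone permutation does carry a loop, so [k = j = 1] is the case that [hne] has to
   exclude. *)
move=> cyc_k cyc_j; apply: hne.
have asc_a i : i.+1 < n -> asc a i = asc a 0.
  move=> lt_in; apply: (@Fine_Wilf_coprime _ (asc a) k j n.-1) => //; try lia.
  - exact: kcycle_asc_period.
  - exact: kcycle_asc_period.
by split; apply: (kcycle_asc_const _ _ asc_a) => //; lia.
Qed.
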